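(* For every integer $n\ge 0$, $$p(n) = 1+\sum_{k>0} f_k\, p(n-k).$$
   Context: For an integer $n\ge 0$, $p(n)$ is the number of partitions of $n$, i.e. of multisets of positive integers whose sum is $n$; thus $p(0)=1$, and by convention $p(n)=0$ for $n<0$ (so the sum in the claim is finite). Euler's coefficients are defined for integers $n\ge 0$ by $e_n=(-1)^{k+1}$ if $n=(3k^2+k)/2$ or $n=(3k^2-k)/2$ for some integer $k\ge 0$, and $e_n=0$ otherwise; in particular $e_0=-1$. The coefficients $f_n$ are defined by $f_n=\sum_{0\le k\le n} e_k$ for $n\ge 0$. *)

(* Defs.v *)
From HB Require Import structures.
From mathcomp Require Import all_boot all_order all_algebra.
From mathcomp Require Import finmap multiset zify.
From mathcomp Require Import boolp classical_sets functions cardinality fsbigop.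

Set Implicit Arguments.
Unset Strict Implicit.
Unset Printing Implicit Defensive.

Local Open Scope mset_scope.
Local Open Scope classical_set_scope.
Local Open Scope nat_scope.

(* In the sum, M is enumerated with multiplicities. *)
Definition partitions (n : nat) : set {mset nat} :=
  [set M | (forall i, i \in M -> 0 < i) /\ \sum_(i <- M) i = n].

(* fset_set is a junk value on infinite sets, so the definition of p below
   is meaningful because of this lemma. *)
Lemma finite_partitions (n : nat) : finite_set (partitions n).
Proof.
pose h (s : n.-bseq 'I_n.+1) : {mset nat} := seq_mset [seq val i | i <- s].
suff sub : partitions n `<=` h @` setT.
  by apply: sub_finite_set sub _; apply: finite_image; exact: finite_finset.
move=> M [Mpos Msum].
have le_sum (s : seq nat) i : i \in s -> i <= \sum_(j <- s) j.
  by move=> si; rewrite (big_rem i si) leq_addr.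
have Mle i : i \in M -> i <= n by rewrite -Msum => iM; apply: le_sum.
have size_le : size [seq (inord i : 'I_n.+1) | i <- M] <= n.
  rewrite size_map -Msum -sum1_size.
  have : forall i, i \in (M : seq nat) -> 0 < i by [].
  elim: (M : seq nat) => [|i s IHs] spos; first by rewrite !big_nil.
  rewrite !big_cons leq_add ?spos ?mem_head // IHs // => j js.
  by rewrite spos // inE js orbT.
exists (Bseq size_le) => //; rewrite /h /= -[RHS]seq_mset_id; congr seq_mset.
rewrite -map_comp -[RHS]map_id; apply/eq_in_map => i iM /=.
by rewrite inordK // ltnS; apply: Mle.
Qed.

(* The argument is an integer so that p (n - k) = 0 for k > n. *)
Definition p (m : int) : nat :=
  match m with
  | Posz n => #|` fset_set (partitions n)|
  | Negz _ => 0
  end.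

(* n is one of the two numbers (3k^2 + k)/2 and (3k^2 - k)/2; the divisions
   are exact and the subtraction is never truncated. *)
Definition pentagonal (k n : nat) : bool :=
  (n == (3 * k ^ 2 + k) %/ 2) || (n == (3 * k ^ 2 - k) %/ 2).

(* The search for k is bounded by n, since pentagonal k n implies k <= n. *)
Definition euler_e (n : nat) : int :=
  if [pick k : 'I_n.+1 | pentagonal k n] is Some k then ((-1) ^+ k.+1)%R
  else 0%R.

Definition euler_f (n : nat) : int := (\sum_(0 <= k < n.+1) euler_e k)%R.

(* euler_e does not depend on the witness k found by pick, nor on the bound. *)
Lemma pentagonalE (k n : nat) :
  pentagonal k n = (2 * n == 3 * k ^ 2 + k) || (2 * n + k == 3 * k ^ 2).
Proof.
have ev : ~~ odd (3 * k ^ 2 + k) && ~~ odd (3 * k ^ 2 - k).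
  rewrite oddD oddB ?oddM ?oddX /=; first by case: (odd k).
  by rewrite expnS expn1; nia.
rewrite /pentagonal; move: ev; have : k <= 3 * k ^ 2 by rewrite expnS expn1; nia.
by move: (k ^ 2) => q kq /andP[]; lia.
Qed.

Lemma euler_e_pentagonal (k n : nat) :
  pentagonal k n -> euler_e n = ((-1) ^+ k.+1)%R.
Proof.
move=> kn; have kle : k < n.+1.
  by move: kn; rewrite pentagonalE expnS expn1; nia.
rewrite /euler_e; case: pickP => [j|/(_ (Ordinal kle))]; last by rewrite kn.
move=> jn; suff -> : nat_of_ord j = k by [].
by move: jn kn; rewrite !pentagonalE !expnS !expn0 !muln1; nia.
Qed.

Lemma euler_e_not_pentagonal (n : nat) :
  (forall k, ~~ pentagonal k n) -> euler_e n = 0%R.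
Proof.
move=> nP; rewrite /euler_e; case: pickP => // k kn.
by move: (nP k); rewrite kn.
Qed.

(* Main.v *)
Require Import Defs.
From mathcomp Require Import all_boot all_order all_algebra.
From mathcomp Require Import finmap multiset zify.
From mathcomp Require Import boolp classical_sets functions cardinality fsbigop.

(** Let P(n) be the product of the 1 - x^i for 1 <= i <= n, and let A(N) be the
generating function of the partitions with all parts at most N.  Two facts
about the coefficients of degree at most n, where n is arbitrary, give the
theorem.

Sorting the partitions by whether N + 1 is a part ([bounded_count_rec]) says
that (1 - x^(N+1)) A(N+1) = A(N), so P(n) A(n) = 1 ([qprod_bounded_count]); and
partitions of integers up to n have no part above n, so A(n) counts them all.

By Euler's pentagonal number theorem, P(n) agrees up to degree n with the
series whose coefficients are the - e_k ([coef_qprod]).  It is obtained from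
Shanks's finite form of that theorem ([shanks]), an identity
   sum_(s <= n) (-1)^s P(n)/P(s) x^(s n + s(s+1)/2) = pentagonal sum up to n,
which holds in every commutative ring and is proved by telescoping; on its left
side only the term s = 0, which is P(n), has monomials of degree at most n.

Comparing coefficients, the convolution of e and p vanishes at every m > 0 and
is -1 at 0 ([euler_recurrence]).  As f is the sequence of partial sums of e, the
convolution of f and p is the sequence of partial sums of that one, hence is
constantly -1 ([euler_f_convolution]).  Since f_0 = -1, its term k = 0 is
- p(n), and solving for p(n) is the claim. *)

Import GRing.Theory.

Local Open Scope mset_scope.
Local Open Scope classical_set_scope.
Local Open Scope nat_scope.

(** * Partitions with bounded parts *)

Definition bounded_partitions (N n : nat) : set {mset nat} :=
  partitions n `&` [set M | forall i, i \in M -> i <= N].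

Definition bounded_count (N n : nat) : nat :=
  #|` fset_set (bounded_partitions N n)|.

Lemma finite_bounded_partitions N n : finite_set (bounded_partitions N n).
Proof. exact: finite_setIl (finite_partitions n). Qed.

Lemma big_msetD1 (a : nat) (M : {mset nat}) :
  \sum_(i <- (a +` M)%mset) i = a + \sum_(i <- M) i.
Proof.
suff /(perm_big _) -> : perm_eq (a +` M)%mset (a :: M) by rewrite big_cons.
apply/allP => b _ /=; rewrite count_mem_mset mset1DE count_mem_mset.
by rewrite [b == a]eq_sym.
Qed.

Lemma bounded_count0 n : bounded_count 0 n = (n == 0).
Proof.
rewrite /bounded_count.
have -> : bounded_partitions 0 n = if n == 0 then [set mset0%mset] else set0.
  apply/seteqP; split=> M /=.
    move=> [[Mpos <-] M0].
    have -> : M = mset0%mset.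
      apply/msetP => i; rewrite mset0E; apply/eqP; rewrite mset_eq0; apply/negP => iM.
      by have := M0 i iM; rewrite leqn0 => /eqP i0; have := Mpos i iM; rewrite i0.
    by rewrite big_mset0.
  case: eqP => [->|_] //= ->; split=> [|i]; last by rewrite in_mset0.
  by split=> [i|]; rewrite ?in_mset0 ?big_mset0.
by case: (n == 0); rewrite ?fset_set1 ?cardfs1 ?fset_set0 ?cardfs0.
Qed.

(** The partitions that have N + 1 as a part arise by adding this part to a
partition of n - (N + 1) that may itself contain N + 1. *)
Lemma bounded_count_rec N n :
  bounded_count N.+1 n =
    bounded_count N n +
    (if N < n then bounded_count N.+1 (n - N.+1) else 0).
Proof.
pose A := if N < n then bounded_partitions N.+1 (n - N.+1) else set0.
have finA : finite_set A.
  by rewrite /A; case: ifP => _ //; exact: finite_bounded_partitions.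
pose add := fun M : {mset nat} => (N.+1 +` M)%mset.
have split_parts :
    bounded_partitions N.+1 n = bounded_partitions N n `|` add @` A.
  apply/seteqP; split=> M /=.
    move=> [[Mpos Msum] Mle].
    have [NM|NM] := boolP (N.+1 \in M); last first.
      left; split=> // i iM; have := Mle i iM.
      by rewrite leq_eqVlt => /predU1P[iE|//]; rewrite -iE iM in NM.
    right.
    have ME : M = add (M `\ N.+1)%mset.
      apply/msetP => i; rewrite /add mset1DE msetB1E.
      by case: eqP => [->|_]; rewrite ?subn0 // subnKC // mset_gt0.
    have := Msum; rewrite ME big_msetD1 => nE.
    exists (M `\ N.+1)%mset => //; rewrite /A ifT; last by lia.
    have subM i : i \in (M `\ N.+1)%mset -> i \in M by rewrite in_msetB1 => /andP[].
    by split; [split=> [i /subM/Mpos //|]; rewrite -nE addKn|move=> i /subM/Mle].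
  case=> [[part Mle]|[M' AM' <-]].
    by split=> // i iM; rewrite leqW ?Mle.
  move: AM'; rewrite /A; case: ltnP => // Nn [[pos sum] le].
  split; [split=> [i|]|move=> i] => /=.
  - by rewrite in_mset1D => /orP[/eqP->|/pos].
  - by rewrite big_msetD1 sum; lia.
  - by rewrite in_mset1D => /orP[/eqP->|/le].
rewrite /bounded_count split_parts fset_setU ?fset_set_image //; last 2 first.
- exact: finite_bounded_partitions.
- exact: finite_image.
rewrite cardfsU disjoint_fsetI0 ?cardfs0 ?subn0; last first.
  apply/fdisjointP => M; rewrite in_fset_set; last exact: finite_bounded_partitions.
  rewrite inE => -[_ Mle]; apply/negP => /imfsetP[M' _ ME].
  by have := Mle N.+1; rewrite ME in_mset1D eqxx ltnn => /(_ isT).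
congr addn; rewrite card_imfset /=; first by rewrite /A; case: ifP; rewrite ?fset_set0.
move=> M1 M2 /msetP eqM; apply/msetP => i.
by have := eqM i; rewrite !mset1DE => /addnI.
Qed.

Lemma bounded_count_all N n : n <= N -> bounded_count N n = p n.
Proof.
move=> nN; rewrite /bounded_count /p; congr (#|` fset_set _|); apply/seteqP; split=> M /=.
  by case.
move=> part; split=> // i iM; apply: leq_trans nN.
by case: part => _ <-; rewrite (big_rem i iM) leq_addr.
Qed.

Local Open Scope ring_scope.

(** * The finite pentagonal number theorem *)

(** For invertible factors this is P(n)/P(s), where P(n) is the product of the
1 - x^i for 1 <= i <= n; leaving out the cancelled factors avoids division. *)
Definition qprod {R : comNzRingType} (x : R) (s n : nat) : R :=
  \prod_(s.+1 <= i < n.+1) (1 - x ^+ i).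

(** The binomial coefficient is s(s+1)/2. *)
Definition shanks_term {R : comNzRingType} (x : R) (n s : nat) : R :=
  (-1) ^+ s * qprod x s n * x ^+ (s * n + 'C(s.+1, 2)).

Lemma qprodnn {R : comNzRingType} (x : R) n : qprod x n n = 1.
Proof. by rewrite /qprod big_geq. Qed.

Lemma qprod_recr {R : comNzRingType} (x : R) s n : (s <= n)%N ->
  qprod x s n.+1 = qprod x s n * (1 - x ^+ n.+1).
Proof. by move=> sn; rewrite /qprod big_nat_recr. Qed.

Lemma qprod_recl {R : comNzRingType} (x : R) s n : (s < n)%N ->
  qprod x s n = (1 - x ^+ s.+1) * qprod x s.+1 n.
Proof. by move=> sn; rewrite /qprod big_ltn. Qed.

(** Write U(m) for the subtracted term.  For s <= n, the factor 1 - x^(n+1) of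
P(n+1)/P(s) splits the term s of the sum for n+1 in two pieces.  The piece from
- x^(n+1) is - U(s).  The piece from 1 exceeds the term s of the sum for n by a
multiple of x^s - 1, which absorbs a factor into P(n)/P(s-1) and gives U(s-1)
(nothing, when s = 0).  So the differences U(s-1) - U(s) telescope. *)
Lemma shanks_sum_diff {R : comNzRingType} (x : R) (n m : nat) : (m <= n)%N ->
  \sum_(0 <= s < m.+1) shanks_term x n.+1 s =
  \sum_(0 <= s < m.+1) shanks_term x n s
  - (-1) ^+ m * qprod x m n * x ^+ (m.+1 * n.+1 + 'C(m.+1, 2)).
Proof.
elim: m => [|m IHm] mn.
  rewrite !big_nat1 /shanks_term qprod_recr // !mul0n mul1n bin_small // !addn0.
  by rewrite !expr0 !mul1r !mulr1 mulrBr mulr1.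
rewrite (big_nat_recr m.+1) //= (big_nat_recr m.+1) //= IHm ?(ltnW mn) //.
rewrite /shanks_term qprod_recr // (qprod_recl _ m n) //.
rewrite !(binS m.+1 1) !bin1.
set c := 'C(m.+1, 2).
(* All exponents are k, m + 1 and n + 1 combined, with k as below; naming the
   powers leaves a polynomial identity. *)
have -> : (m.+1 * n.+1 + c = (m.+1 * n + c) + m.+1)%N by lia.
have -> : (m.+1 * n.+1 + (c + m.+1) = (m.+1 * n + c) + m.+1 + m.+1)%N by lia.
have -> : (m.+1 * n + (c + m.+1) = (m.+1 * n + c) + m.+1)%N by lia.
have -> : (m.+2 * n.+1 + (c + m.+1) = (m.+1 * n + c) + m.+1 + m.+1 + n.+1)%N by lia.
move: (m.+1 * n + c)%N => k; rewrite !(exprD x) (exprS (-1)).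
move: (x ^+ k) (x ^+ m.+1) (x ^+ n.+1) => t y z.
move: ((-1) ^+ m) (qprod x m.+1 n) (\sum_(0 <= s < m.+1) _) => e Q S.
move: (t * y) => u.
have -> : e * ((1 - y) * Q) * u = e * Q * u - e * Q * u * y.
  by rewrite (mulrC (1 - y)) (mulrA e) mulrAC mulrBr mulr1.
have -> : -1 * e * (Q * (1 - z)) * (u * y)
    = e * Q * u * y * z - e * Q * u * y.
  by rewrite mulN1r !mulNr (mulrA e) mulrAC mulrBr mulr1 opprB !mulrA.
rewrite mulN1r !mulNr opprK !mulrA opprB -!addrA; congr (S + _).
by rewrite addrCA (addrC (_ * y)) subrK.
Qed.

Definition pentagonal_sum {R : comNzRingType} (x : R) n : R :=
  1 + \sum_(1 <= k < n.+1)
    (-1) ^+ k * (x ^+ ((3 * k ^ 2 - k) %/ 2) + x ^+ ((3 * k ^ 2 + k) %/ 2)).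

(** From n to n+1, the old terms change in total by minus the last U, which is
one of the two new pentagonal monomials with its sign; the new term s = n+1 is
the other. *)
Lemma shanks {R : comNzRingType} (x : R) (n : nat) :
  \sum_(0 <= s < n.+1) shanks_term x n s = pentagonal_sum x n.
Proof.
elim: n => [|n IHn].
  rewrite big_nat1 /pentagonal_sum big_geq // /shanks_term qprodnn.
  by rewrite bin_small // !expr0 !mul1r addr0.
rewrite big_nat_recr //= shanks_sum_diff // IHn /pentagonal_sum.
rewrite (big_nat_recr n.+1) //= /shanks_term !qprodnn !mulr1.
have bE : ('C(n.+2, 2) = 'C(n.+1, 2) + n.+1)%N by rewrite binS bin1.
have cE : (2 * 'C(n.+1, 2) = n.+1 * n)%N by rewrite -mul_bin_diag bin1.
have -> : ((3 * n.+1 ^ 2 - n.+1) %/ 2 = n.+1 * n.+1 + 'C(n.+1, 2))%N.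
  by rewrite -mulnn; nia.
have -> : ((3 * n.+1 ^ 2 + n.+1) %/ 2 = n.+1 * n.+1 + 'C(n.+2, 2))%N.
  by rewrite -mulnn; nia.
by rewrite exprS !mulN1r !mulNr mulrDr opprD !addrA.
Qed.

(** * Comparison of coefficients *)

(** Truncation at n loses nothing: a pentagonal number with index j is at least
j, so those up to n have index at most n.  No two indices share one. *)
Lemma coef_pentagonal_sum n k : (k <= n)%N ->
  (pentagonal_sum ('X : {poly int}) n)`_k = - euler_e k.
Proof.
move=> kn.
(* The constant 1 is the term j = 0, where the two pentagonal numbers coincide
   and must be counted once. *)
have -> : (pentagonal_sum ('X : {poly int}) n)`_k =
    \sum_(0 <= j < n.+1) (-1) ^+ j * (pentagonal j k)%:R :> int.
  rewrite /pentagonal_sum coefD coef1 coef_sum [RHS]big_ltn //=.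
  rewrite expr0 mul1r; congr (_ + _).
    by rewrite /pentagonal /= orbb.
  apply: eq_big_nat => j /andP[j0 _].
  have -> : (-1) ^+ j = ((-1) ^+ j)%:P :> {poly int} by rewrite rmorphXn rmorphN1.
  rewrite coefCM coefD !coefXn /pentagonal; congr (_ * _).
  have : ((3 * j ^ 2 + j) %/ 2 != (3 * j ^ 2 - j) %/ 2)%N by rewrite -mulnn; nia.
  by case: (k =P (_ + _) %/ 2)%N => [<-|_] neq; rewrite ?addr0 // ?(negPf neq) // add0r.
have [[j kj]|noj] := pselect (exists j, pentagonal j k); last first.
  rewrite euler_e_not_pentagonal ?oppr0 => [|j]; last first.
    by apply/negP => kj; apply: noj; exists j.
  apply: big1_seq => j _; case kj: (pentagonal j k); last by rewrite mulr0.
  by case: noj; exists j.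
rewrite (euler_e_pentagonal kj) exprS mulN1r opprK.
have jn : (j < n.+1)%N.
  by move: kj; rewrite pentagonalE -mulnn; nia.
rewrite (bigD1_seq j) ?mem_index_iota ?iota_uniq //= kj mulr1.
rewrite big1_seq ?addr0 // => i /andP[ij _].
case ki: (pentagonal i k); last by rewrite mulr0.
by move: ki kj ij; rewrite !pentagonalE -!mulnn; nia.
Qed.

(** In Shanks's identity the term s > 0 is divisible by x^(s n + s(s+1)/2), hence
by x^(n+1), and does not contribute. *)
Lemma coef_qprod n k : (k <= n)%N ->
  (qprod ('X : {poly int}) 0 n)`_k = - euler_e k.
Proof.
move=> kn; rewrite -(coef_pentagonal_sum n) // -shanks big_ltn // coefD coef_sum.
rewrite big_nat big1 ?addr0 => [|s /andP[s0 _]].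
  by rewrite /shanks_term mul0n bin_small // !expr0 mul1r mulr1.
rewrite /shanks_term coefMXn ifT //.
have : (0 < 'C(s.+1, 2))%N by rewrite bin_gt0.
by nia.
Qed.

(** Each factor 1 - x^(N+1) turns the generating function for the bound N + 1 into
the one for N, leaving 1 for N = 0.  The truncation at L replaces the power
series by a polynomial without affecting the coefficients below L. *)
Lemma qprod_bounded_count N L m : (m < L)%N ->
  (qprod ('X : {poly int}) 0 N * \poly_(i < L) (bounded_count N i)%:Z)`_m =
    (m == 0%N)%:R.
Proof.
elim: N m => [|N IHN] m mL.
  by rewrite qprodnn mul1r coef_poly mL bounded_count0; case: (m == 0%N).
rewrite -[RHS]IHN // qprod_recr // -mulrA !coefM; apply: eq_bigr => i _.
congr (_ * _); set j := (m - i)%N.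
have jL : (j < L)%N by rewrite (leq_ltn_trans _ mL) // leq_subr.
rewrite mulrBl mul1r coefB coefXnM !coef_poly jL (bounded_count_rec N j) ltnS.
rewrite (leq_ltn_trans (leq_subr _ _) jL) PoszD.
by case: ltnP; rewrite ?subr0 ?addr0 ?addrK.
Qed.

Lemma euler_recurrence m :
  \sum_(i < m.+1) euler_e i * (p (m - i)%N)%:Z = - (m == 0%N)%:R.
Proof.
rewrite -(qprod_bounded_count m m.+1) // coefM -sumrN; apply: eq_bigr => -[i /= im] _.
rewrite coef_qprod // coef_poly ltnS leq_subr bounded_count_all ?leq_subr //.
by rewrite mulNr opprK.
Qed.

(** Since f_(i+1) = f_i + e_(i+1) and f_0 = e_0, passing from m to m + 1 adds the
convolution of e and p at m + 1, which is 0. *)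
Lemma euler_f_convolution m : \sum_(i < m.+1) euler_f i * (p (m - i)%N)%:Z = -1.
Proof.
elim: m => [|m IHm].
  by rewrite -[RHS](euler_recurrence 0) !big_ord1 /euler_f big_nat1.
have := euler_recurrence m.+1; rewrite oppr0 big_ord_recl => rec.
rewrite -[RHS]IHm -[RHS]addr0 -[X in _ = _ + X]rec [LHS]big_ord_recl [RHS]addrCA.
congr (_ * _ + _); first by rewrite /euler_f big_nat1.
rewrite -big_split /=; apply: eq_bigr => i _.
by rewrite /bump /= add1n subSS /euler_f (big_nat_recr i.+1) //= mulrDl.
Qed.

(* The sum over all k > 0 is a finitely supported sum: the terms with k > n
   vanish. *)
Theorem claim1 (n : nat) :
  (p n%:Z)%:Z =
    1 + \sum_(k \in [set k : nat | (0 < k)%N])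
          euler_f k * (p (n%:Z - k%:Z))%:Z.
Proof.
pose F k := euler_f k * (p (n%:Z - k%:Z))%:Z.
have -> : \sum_(k \in [set k : nat | (0 < k)%N]) F k = \sum_(1 <= k < n.+1) F k.
  rewrite (@fsbigE _ _ _ _ _ (index_iota 1 n.+1)) ?iota_uniq //.
  - rewrite big_nat_cond [RHS]big_nat_cond; apply: eq_bigl => k.
    by rewrite andbT andb_idr // => /andP[k0 _]; apply: mem_set.
  - by move=> k /=; rewrite mem_index_iota => /andP[].
  - move=> k /= k0; rewrite mem_index_iota k0 /= -leqNgt => nk.
    have [d nkd] : exists d, n%:Z - k%:Z = Negz d by exists (k - n).-1; lia.
    by rewrite /F nkd mulr0.
have := euler_f_convolution n.
have -> : \sum_(i < n.+1) euler_f i * (p (n - i)%N)%:Z = \sum_(0 <= k < n.+1) F k.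
  by rewrite big_mkord; apply: eq_bigr => i _; rewrite /F subzn // -ltnS.
rewrite big_ltn // {1}/F subr0 /euler_f big_nat1 (@euler_e_pentagonal 0) // expr1.
rewrite mulN1r => sumF.
by rewrite -[1]opprK -sumF opprD opprK subrK.
Qed.
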